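(* Let $\mathcal{H}=L^2([0,1])$, let $\{\varepsilon_k\}_{k\in\mathbb{Z}}$ be i.i.d. random functions in $\mathcal{H}$, let $\delta\in\mathcal{H}^+$, and let $\beta$ be a bounded non-negative kernel operator on $\mathcal{H}$, $\beta(x)(t)=\int\beta(t,s)x(s)\,ds$. Assume that there is some $\alpha>0$ such that $E\{K(\varepsilon_1^2)\}^\alpha<1$, where $K(\varepsilon_1^2)=\big(\int\int\beta^2(t,s)\varepsilon_1^4(s)\,ds\,dt\big)^{1/2}$. Let $\sigma_k^2=g(\varepsilon_{k-1},\varepsilon_{k-2},\ldots)$ be the unique strictly stationary solution in $\mathcal{H}$ of $y_k=\varepsilon_k\sigma_k$, $\sigma_k^2=\delta+\beta(y_{k-1}^2)$, $k\in\mathbb{Z}$. Let $\{\varepsilon_k'\}$ be an independent copy of $\{\varepsilon_k\}$ and, for $m\ge1$, define $$\sigma_{km}^2=g(\varepsilon_{k-1},\varepsilon_{k-2},\ldots,\varepsilon_{k-m},\varepsilon_{k-m-1}',\varepsilon_{k-m-2}',\ldots).$$ Then, for some $0<r=r(\alpha)<1$ and $c=c(\alpha)<\infty$, $$E\{\|\sigma_k^2-\sigma_{km}^2\|_{\mathcal{H}}\}^\alpha\le c\,r^m\qquad\text{for all } k\in\mathbb{Z},\ m\ge1.$$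
   Context: All integrals are over $[0,1]$. $\mathcal{H}=L^2([0,1])$ has norm $\|x\|_{\mathcal{H}}=(\int x^2(s)ds)^{1/2}$; $\mathcal{H}^+$ is the set of non-negative functions in $\mathcal{H}$. Products, squares and square roots of functions are pointwise. A non-negative operator is one mapping $\mathcal{H}^+$ into $\mathcal{H}^+$; the same symbol $\beta$ denotes the kernel and the operator. A solution in $\mathcal{H}$ is a process $\{(y_k,\sigma_k^2)\}_{k\in\mathbb{Z}}$ such that $\sigma_k^2$ is a random element of $\mathcal{H}^+$, $\sigma_k\ge 0$ is its pointwise square root, $y_k=\varepsilon_k\sigma_k$, and $\sigma_k^2(t)=\delta(t)+\int\beta(t,s)y_{k-1}^2(s)\,ds$ for a.e. $t$, almost surely. Under the stated condition $E\{K(\varepsilon_1^2)\}^\alpha<1$ there is a unique strictly stationary solution, and it satisfies $\sigma_k^2=g(\varepsilon_{k-1},\varepsilon_{k-2},\ldots)$ for a measurable functional $g:\mathcal{H}^{\mathbb{N}}\to\mathcal{H}$ not depending on $k$. *)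

(* Defs.v *)
From HB Require Import structures.
From mathcomp Require Import all_boot all_order all_algebra.
From mathcomp Require Import all_classical all_reals all_analysis measurable_realfun.

Set Implicit Arguments.
Unset Strict Implicit.
Unset Printing Implicit Defensive.

Import Order.TTheory GRing.Theory Num.Theory.

Local Open Scope classical_set_scope.
Local Open Scope ring_scope.

(* Lebesgue measure carried by [0, 1]. Functions on [0, 1] are functions on the
   line taken modulo mu01-a.e. equality, hence modulo their values off [0, 1]. *)
Definition mu01 (R : realType) : set (measurableTypeR R) -> \bar R :=
  mrestr lebesgue_measure (measurable_itv `[0 : R, 1 : R]).
HB.instance Definition _ (R : realType) := Measure.on (@mu01 R).
Arguments mu01 : clear implicits.

(* Elements of L0 and Hsp are a.e.-classes: applying one to a point goes through
   a chosen representative, so it is only meaningful up to mu01-null sets. *)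
Definition L0 (R : realType) : Type :=
  {mfun_ (mu01 R), measurableTypeR R >-> measurableTypeR R}.

Definition Hsp (R : realType) : Type := LspaceType2 (mu01 R).

Definition L0_fun (R : realType) (x : L0 R) : measurableTypeR R -> R :=
  @aqEqMfun_to_fun _ _ R _ _ _ x.
Coercion L0_fun : L0 >-> Funclass.

Definition H_fun (R : realType) (x : Hsp R) : measurableTypeR R -> R :=
  L0_fun (LebesgueSpace.sort x).
Coercion H_fun : Hsp >-> Funclass.

(* The class of the null function makes L0 and Hsp pointed types, as the library
   requires of measurable spaces. *)
Section pointed.
Variable R : realType.

HB.instance Definition _ := Choice.on (L0 R).
HB.instance Definition _ := gen_eqMixin (Hsp R).
HB.instance Definition _ := gen_choiceMixin (Hsp R).

Let zero_fun : {mfun measurableTypeR R >-> measurableTypeR R} := cst 0.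

Definition zero_L0 : L0 R :=
  (\pi_({mfun_ (mu01 R), measurableTypeR R >-> measurableTypeR R}) zero_fun)%qT.

Lemma finite_norm_zero_L0 : finite_norm (mu01 R) 2%:E zero_L0.
Proof.
have : (repr zero_L0 == zero_fun
    %[mod {mfun_ (mu01 R), measurableTypeR R >-> measurableTypeR R}])%qT.
  by rewrite reprK.
rewrite eqmodE => /asboolP aez; rewrite /finite_norm.
suff -> : ('N[mu01 R]_2%:E[EFin \o zero_L0] = 0)%E by [].
rewrite unlock /Lnorm (ae_eq_integral (cst 0%E))//.
- by rewrite integral0 poweR0r// invr_neq0.
- apply/measurable_EFinP.
  apply: (@measurableT_comp _ _ _ _ _ _ (@powR R ^~ 2)) => //.
  apply: measurableT_comp => //; exact: (@measurable_funPT _ _ _ _ (repr zero_L0)).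
- apply: filterS aez => t /= e _.
  by rewrite [zero_L0 t](e I) normr0 powR0.
Qed.

HB.instance Definition _ := isPointed.Build (L0 R) zero_L0.

Definition zero_H : Hsp R := LebesgueSpace.Pack (LebesgueSpace.Class
  (isFinLebesgue.Build _ _ _ _ _ (lee1n 2) zero_L0 finite_norm_zero_L0)).

HB.instance Definition _ := isPointed.Build (Hsp R) zero_H.
End pointed.

Section distances.
Variable R : realType.
Local Open Scope ereal_scope.

Definition normH (x : Hsp R) : \bar R := 'N[mu01 R]_2%:E[(fun t => (x t)%:E)].

Definition distH (x z : Hsp R) : \bar R :=
  'N[mu01 R]_2%:E[(fun t => (x t - z t)%:E)].

Definition dist0 (x z : L0 R) : \bar R :=
  \int[mu01 R]_t (Num.min `|x t - z t| 1)%:E.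

Definition metric_open (T : Type) (D : T -> T -> \bar R) : set (set T) :=
  [set U | forall x, U x ->
     exists2 e : R, (0 < e)%R & forall z, D x z < e%:E -> U z].
End distances.

(* Hsp carries its Borel sigma-algebra, L0 that of convergence in measure. *)
HB.instance Definition _ (R : realType) :=
  Measurable.copy (Hsp R) (g_sigma_algebraType (metric_open (@distH R))).
HB.instance Definition _ (R : realType) :=
  Measurable.copy (L0 R) (g_sigma_algebraType (metric_open (@dist0 R))).

(* I -> T with the product sigma-algebra. *)
Definition cylinders (I : Type) d (T : measurableType d) : set (set (I -> T)) :=
  [set C | exists i (A : set T), measurable A /\ C = [set x | A (x i)]].

Definition paths (I : Type) d (T : measurableType d) : Type :=
  g_sigma_algebraType (@cylinders I d T).
HB.instance Definition _ (I : Type) d (T : measurableType d) :=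
  Measurable.copy (paths I T) (g_sigma_algebraType (@cylinders I d T)).

Section processes.
Variables (R : realType) (d : measure_display) (Omega : measurableType d).
Variable P : probability Omega R.

Section elements.
Variables (d' : measure_display) (T : measurableType d').

Definition same_law (X Y : Omega -> T) : Prop :=
  forall A, measurable A -> P (X @^-1` A) = P (Y @^-1` A).

Definition independent_elements (X Y : Omega -> T) : Prop :=
  forall A A', measurable A -> measurable A' ->
    P (X @^-1` A `&` Y @^-1` A') = (P (X @^-1` A) * P (Y @^-1` A'))%E.
End elements.

Section sequences.
Variables (d' : measure_display) (T : measurableType d').
Implicit Types X Y : int -> Omega -> T.

Definition random_elements X : Prop :=
  forall k, measurable_fun [set: Omega] (X k).

Definition mutually_independent X : Prop :=
  forall (s : seq int) (A : int -> set T), uniq s ->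
    (forall k, measurable (A k)) ->
    P [set w | forall k, k \in s -> A k (X k w)] =
    (\prod_(k <- s) P (X k @^-1` A k))%E.

Definition iid X : Prop :=
  [/\ random_elements X, mutually_independent X &
      forall k l, same_law (X k) (X l)].

Definition path_of X (w : Omega) : paths int T := fun k => X k w.

Definition independent_copy X Y : Prop :=
  [/\ random_elements Y, same_law (path_of X) (path_of Y) &
      independent_elements (path_of X) (path_of Y)].

Definition strictly_stationary X : Prop :=
  random_elements X /\
  forall h : int, same_law (path_of X) (path_of (fun k => X (k + h))).
End sequences.
End processes.

Section model.
Variable R : realType.

Definition Hplus (x : Hsp R) : Prop :=
  {ae mu01 R, forall t : measurableTypeR R, 0 <= x t}.

(* The integral operator B with kernel beta. Only the values of beta on
   [0, 1]^2 matter, so beta may be taken measurable on the whole plane. *)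
Definition kernel_operator (beta : R -> R -> R) (B : Hsp R -> Hsp R) : Prop :=
  measurable_fun [set: measurableTypeR R * measurableTypeR R]
    (fun ts => beta ts.1 ts.2) /\
  forall x : Hsp R, {ae mu01 R, forall t : measurableTypeR R,
    (mu01 R).-integrable setT (fun s => (beta t s * x s)%:E) /\
    (B x t)%:E = (\int[mu01 R]_s (beta t s * x s)%:E)%E}.

Definition bounded_operator (B : Hsp R -> Hsp R) : Prop :=
  exists C : R, forall x, (normH (B x) <= C%:E * normH x)%E.

Definition nonneg_operator (B : Hsp R -> Hsp R) : Prop :=
  forall x, Hplus x -> Hplus (B x).

(* This is K evaluated at x^2, hence the fourth power; it may be +oo. *)
Definition Kcoef (beta : R -> R -> R) (x : Hsp R) : \bar R :=
  ((\int[mu01 R]_t \int[mu01 R]_s (beta t s ^+ 2 * x s ^+ 4)%:E) `^ 2^-1)%E.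

(* y_k need not be square integrable, nor y_k^2 be in Hsp: y_k lives in L0, and
   the integral is taken in \bar R. *)
Definition solution d (Omega : measurableType d) (P : probability Omega R)
    (eps : int -> Omega -> Hsp R) (delta : Hsp R) (beta : R -> R -> R)
    (y : int -> Omega -> L0 R) (sigma2 : int -> Omega -> Hsp R) : Prop :=
  [/\ random_elements y, random_elements sigma2 &
      forall k, {ae P, forall w,
        [/\ Hplus (sigma2 k w),
            {ae mu01 R, forall s : measurableTypeR R,
               y k w s = eps k w s * Num.sqrt (sigma2 k w s)} &
            {ae mu01 R, forall t : measurableTypeR R, (sigma2 k w t)%:E =
               ((delta t)%:E +
                \int[mu01 R]_s (beta t s * (y (k - 1) w s) ^+ 2)%:E)%E}]}].

Definition past (Omega : Type) (eps : int -> Omega -> Hsp R) (k : int)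
    (w : Omega) : paths nat (Hsp R) :=
  fun j => eps (k - 1 - j%:Z) w.

Definition coupled_past (Omega : Type) (eps eps' : int -> Omega -> Hsp R)
    (k : int) (m : nat) (w : Omega) : paths nat (Hsp R) :=
  fun j => if (j < m)%N then eps (k - 1 - j%:Z) w else eps' (k - 1 - j%:Z) w.
End model.

(* Main.v *)
Require Import Defs.
From HB Require Import structures.
From mathcomp Require Import all_boot all_order all_algebra.
From mathcomp Require Import lra ring zify.
From mathcomp Require Import all_classical all_reals all_analysis measurable_realfun.

(** By Cauchy-Schwarz, one step of the recursion is Lipschitz in [sigma2] with
    constant [K(eps^2)].  The coupled past has the same law as the past, so
    [g] evaluated at it satisfies the same recursion almost surely, and the two
    solutions share [m] innovations: their distance is at most the product of
    [m] values of [K] times the distance of two solutions at time [k - m].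
    Taking powers [alpha] and expectations, independence of the first coordinate
    of the past from the others gives [(E K^alpha)^m] times the moment
    [E ||sigma2||^alpha], which is finite because [||sigma2||^alpha] is
    stationary and satisfies an affine recursion that contracts in mean. *)

Set Implicit Arguments.
Unset Strict Implicit.

Import Order.TTheory GRing.Theory Num.Theory.

Local Open Scope classical_set_scope.
Local Open Scope ring_scope.

(** The delicate point is measurability. The recursion is an almost everywhere identity between
    classes, and passing it to the coupled past by equality of laws requires the paths that satisfy
    it to form a measurable set. Representatives picked class by class give no joint measurability
    in the random element and the point of [[0, 1]], so Tonelli does not apply to them; Lebesgue
    differentiation supplies a jointly measurable version instead. The other obstacle is the moment.
    [g] is known only as a measurable functional solving the recursion, not as a series, so no
    moment is available beforehand, and taking expectations in the recursion might only compare
    infinite quantities; truncation combined with stationarity avoids this. For arbitrary [alpha],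
    the power of a sum is split with unequal weights, so that the factor put on the contracting term
    is absorbed by the gap between [E K^alpha] and 1. *)

Section unit_interval_measure.
Variable R : realType.
Local Open Scope ereal_scope.

(** Finiteness gives the sigma-finiteness on which Tonelli and the measurability of sections
    rest. *)
Lemma mu01_finite : fin_num_fun (mu01 R).
Proof.
move=> A mA; rewrite ge0_fin_numE//.
apply: (@le_lt_trans _ _ (lebesgue_measure `[0%R : R, 1%R])).
  rewrite /mu01 /mrestr; apply: le_measure; rewrite ?inE //=.
  exact: measurableI.
by rewrite lebesgue_measure_itv /= lte_fin ltr01 sube0 ltry.
Qed.

HB.instance Definition _ := Measure_isFinite.Build _ _ _ (mu01 R) mu01_finite.

Lemma mu01T : mu01 R setT = 1.
Proof.
by rewrite /mu01 /mrestr setTI lebesgue_measure_itv /= lte_fin ltr01 sube0.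
Qed.

Lemma integral_mu01 (D : set (measurableTypeR R)) (f : R -> \bar R) :
  D `<=` `[0%R, 1%R] ->
  \int[mu01 R]_(x in D) f x = \int[lebesgue_measure]_(x in D) f x.
Proof.
move=> D01; apply: eq_measure_integral => A mA AD.
transitivity (lebesgue_measure (A `&` `[0%R : R, 1%R])) => //.
by rewrite setIidl//; exact: subset_trans D01.
Qed.

Lemma mu01_compl_itv : (mu01 R).-negligible (~` `[0%R, 1%R]).
Proof.
exists (~` `[0%R, 1%R]); split => //; first exact: measurableC.
by rewrite /mu01 /mrestr setICl measure0.
Qed.

Lemma lebesgue_ae_mu01 (Q : R -> Prop) :
  {ae (@lebesgue_measure R), forall t, Q t} ->
  {ae mu01 R, forall t : measurableTypeR R, Q t}.
Proof.
case=> N [mN N0 QN]; exists N; split => //.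
apply/eqP; rewrite -measure_le0 -N0.
by apply: le_measure; rewrite ?inE //=; exact: measurableI.
Qed.

Lemma mu01_ae_itv :
  {ae mu01 R, forall t : measurableTypeR R, (0 <= t <= 1)%R}.
Proof.
move: mu01_compl_itv; apply: negligibleS => t /= tn.
by rewrite in_itv.
Qed.

End unit_interval_measure.

(** * Norm and distance of the Hilbert space *)

Section Hsp_basics.
Variable R : realType.
Local Open Scope ereal_scope.
Implicit Types x z : Hsp R.

Lemma measurable_H x : measurable_fun [set: measurableTypeR R] x.
Proof. exact: (@measurable_funPT _ _ _ _ (repr (LebesgueSpace.sort x))). Qed.

Lemma normH_lty x : normH x < +oo.
Proof. exact: (@Lebesgue_finite _ _ _ _ _ _ x). Qed.

Lemma normH_ge0 x : 0 <= normH x.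
Proof. exact: Lnorm_ge0. Qed.

Lemma distH_ge0 x z : 0 <= distH x z.
Proof. exact: Lnorm_ge0. Qed.

Lemma Lnorm2E (f : R -> R) :
  'N[mu01 R]_2%:E[EFin \o f] = (\int[mu01 R]_t (f t ^+ 2)%:E) `^ 2^-1.
Proof.
rewrite unlock; congr (_ `^ _); apply: eq_integral => t _ /=.
by rewrite powR_mulrn// -normrX ger0_norm// sqr_ge0.
Qed.

Lemma distH_triangle z x x' : distH x x' <= distH x z + distH z x'.
Proof.
have le12 : (1 <= 2 :> R)%R by rewrite ler1n.
have := @minkowski_EFin _ _ _ (mu01 R) _ _ 2
  (measurable_funB (measurable_H x) (measurable_H z))
  (measurable_funB (measurable_H z) (measurable_H x')) le12.
apply: le_trans; rewrite le_eqVlt; apply/orP; left; apply/eqP.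
by apply: eq_Lnorm => t /=; rewrite addrA subrK.
Qed.

Lemma distHC x z : distH x z = distH z x.
Proof.
rewrite /distH -Lnorm_abse -[RHS]Lnorm_abse; apply: eq_Lnorm => t /=.
by rewrite distrC.
Qed.

Lemma zero_HE : {ae mu01 R, forall t : measurableTypeR R, zero_H R t = 0%R}.
Proof.
pose zero_fun : {mfun measurableTypeR R >-> measurableTypeR R} := cst 0%R.
have : (repr (zero_L0 R) == zero_fun
    %[mod {mfun_ (mu01 R), measurableTypeR R >-> measurableTypeR R}])%qT.
  by rewrite reprK.
by rewrite eqmodE => /asboolP; apply: filterS => t /(_ I).
Qed.

Lemma distH0 x : distH x (zero_H R) = normH x.
Proof.
rewrite /distH /normH !Lnorm2E; congr (_ `^ _); apply: ae_eq_integral => //.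
- by apply/measurable_EFinP/measurable_funX/measurable_funB;
    exact: measurable_H.
- by apply/measurable_EFinP/measurable_funX; exact: measurable_H.
- by apply: filterS zero_HE => t /= ->; rewrite subr0.
Qed.

Lemma distH_lty x z : distH x z < +oo.
Proof.
apply: le_lt_trans (distH_triangle (zero_H R) x z) _.
by rewrite (distHC (zero_H R)) !distH0 lte_add_pinfty// normH_lty.
Qed.

Lemma cauchy_schwarz (f h : R -> R) :
  measurable_fun [set: measurableTypeR R] f ->
  measurable_fun [set: measurableTypeR R] h ->
  \int[mu01 R]_t `|f t * h t|%:E <=
  'N[mu01 R]_2%:E[EFin \o f] * 'N[mu01 R]_2%:E[EFin \o h].
Proof.
move=> mf mh; have := @hoelder _ _ _ (mu01 R) _ _ 2 2 mf mh.
rewrite Lnorm1; apply => //; by rewrite -[(2^-1)%R]div1r -splitr.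
Qed.
End Hsp_basics.

(** * A jointly measurable evaluation, by Lebesgue differentiation *)

Section cell_averages.
Import numFieldNormedType.Exports.
Variable R : realType.
Local Open Scope ereal_scope.
Implicit Types x z : Hsp R.

Lemma integrable_H x : (mu01 R).-integrable setT (EFin \o x).
Proof.
apply/integrableP; split; first by apply/measurable_EFinP; exact: measurable_H.
have := cauchy_schwarz (measurable_H x)
  (@measurable_cst _ _ _ (measurableTypeR R) setT 1%R).
rewrite Lnorm_cst1; under eq_integral do rewrite mulr1.
move/le_lt_trans; apply; rewrite [X in _ * X `^ _]mu01T poweR1r mule1.
exact: normH_lty.
Qed.

(** A 1-Lipschitz function pulls open half-lines back to open sets for [distH], which generate the
    sigma-algebra. *)
Lemma measurable_Hsp_fun (F : Hsp R -> R) :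
  (forall x z, `|(F x - F z)%:E| <= distH x z) -> measurable_fun setT F.
Proof.
move=> F_lip; apply: (measurability _ (RGenOInfty.measurableE R)) => //.
move=> _ [_ [a ->] <-]; rewrite setTI; apply: sub_sigma_algebra => x /=.
rewrite in_itv /= andbT => ax; exists (F x - a)%R; first by rewrite subr_gt0.
move=> z xz /=; rewrite in_itv /= andbT.
have := le_lt_trans (F_lip x z) xz.
by rewrite lte_fin => /ltr_normlW; lra.
Qed.

Definition cell (n : nat) (k : int) : set (measurableTypeR R) :=
  `[(k%:~R / n.+1%:R)%R, ((k%:~R + 1) / n.+1%:R)%R[.

Definition cell_mean (n : nat) (k : int) x : R :=
  (n.+1%:R * fine (\int[mu01 R]_(s in cell n k) (x s)%:E))%R.

(** Before scaling, the integral over a cell is 1-Lipschitz in [x]: Cauchy-Schwarz against the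
    constant 1, on a space of mass one. *)
Lemma measurable_cell_mean n k : measurable_fun setT (cell_mean n k).
Proof.
apply: measurable_funM => //; apply: measurable_Hsp_fun => x z.
have mc : measurable (cell n k) by exact: measurable_itv.
have icell (y : Hsp R) : (mu01 R).-integrable (cell n k) (EFin \o y).
  by apply: integrableS (integrable_H y).
rewrite EFinB !fineK ?integrable_fin_num//; [|exact: icell..].
rewrite -integralB_EFin//; [|exact: icell..].
apply: (le_trans (le_abse_integral _ _ _)) => //.
  apply/measurable_EFinP/measurable_funTS/measurable_funB; exact: measurable_H.
apply: (@le_trans _ _ (\int[mu01 R]_s `|(x s - z s)%:E|)).
  apply: ge0_subset_integral => //.
  by apply: measurableT_comp => //; apply/measurable_EFinP/measurable_funB;
    exact: measurable_H.
have := cauchy_schwarz (measurable_funB (measurable_H x) (measurable_H z))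
  (@measurable_cst _ _ _ (measurableTypeR R) setT 1%R).
rewrite Lnorm_cst1; under eq_integral do rewrite mulr1.
by move/le_trans; apply; rewrite [X in _ * X `^ _]mu01T poweR1r mule1.
Qed.

Definition approx_ev (n : nat) (p : Hsp R * measurableTypeR R) : R :=
  cell_mean n (Num.floor (n.+1%:R * p.2)%R) p.1.

Lemma measurable_approx_ev n : measurable_fun setT (approx_ev n).
Proof.
move=> _ B mB; rewrite setTI.
rewrite [X in measurable X](_ : _ = \bigcup_(k : int)
    ((cell_mean n k @^-1` B) `*` [set t | Num.floor (n.+1%:R * t)%R = k])).
  apply: countable_bigcupT_measurable => // k; apply: measurableX.
    by rewrite -[X in measurable X]setTI; exact: measurable_cell_mean.
  rewrite [X in measurable X](_ : _ = cell n k); first exact: measurable_itv.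
  apply/seteqP; split => t; rewrite /cell /= in_itv /=.
    move=> <-; rewrite ler_pdivrMr// ltr_pdivlMr// [(t * _)%R]mulrC.
    by have := floor_itv (n.+1%:R * t)%R; rewrite intrD.
  rewrite ler_pdivrMr// ltr_pdivlMr// [(t * _)%R]mulrC => tk.
  by apply: floor_def; rewrite intrD.
apply/seteqP; split => [[x t] /= Bxt|[x t] [k _ [/= Bxt tk]]].
  by exists (Num.floor (n.+1%:R * t)%R).
by rewrite /approx_ev /= tk.
Qed.

Lemma lebesgue_cell n k : lebesgue_measure (cell n k) = (n.+1%:R^-1)%:E.
Proof.
rewrite /cell lebesgue_measure_itv /= lte_fin ltr_pM2r ?invr_gt0//.
by rewrite ltrDl ltr01 -EFinB mulrDl mul1r addrC addrA addNr add0r.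
Qed.

Lemma nicely_shrinking_cell (t : R) :
  nicely_shrinking t (fun n => cell n (Num.floor (n.+1%:R * t)%R)).
Proof.
split; first by move=> n; exact: measurable_itv.
have cell_sub n (k := Num.floor (n.+1%:R * t)%R) :
    (k%:~R / n.+1%:R <= t < (k%:~R + 1) / n.+1%:R)%R.
  rewrite ler_pdivrMr// ltr_pdivlMr// [(t * _)%R]mulrC.
  by have := floor_itv (n.+1%:R * t)%R; rewrite intrD.
have r0 n : (0 < n.+1%:R^-1 :> R)%R by rewrite invr_gt0.
(* A half-open cell of length [1 / n.+1] containing [t] lies in the open ball of that radius, whose
   measure is twice as large. *)
exists (2%R, (fun n => PosNum (r0 n))); split => //=.
- have := @cvg_harmonic R; exact: cvg_trans.
- move=> n s; rewrite /cell /= in_itv /= /ball /= => /andP[ks sk].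
  have /andP[kt tk] := cell_sub n; rewrite ltr_norml.
  move: ks sk kt tk; rewrite mulrDl mul1r.
  move: ((Num.floor (n.+1%:R * t))%:~R / n.+1%:R)%R => a.
  move: (n.+1%:R^-1)%R => b ks sk kt tk.
  by apply/andP; split; lra.
- move=> n; rewrite lebesgue_cell lebesgue_measure_ball//.
  by rewrite -EFinM lee_fin mulr_natl.
Qed.

(* A representative of [x : Hsp R] that is jointly measurable in [(x, t)], which
   the one chosen by the quotient need not be: the limit of cell averages. *)
Definition ev (p : Hsp R * measurableTypeR R) : R :=
  fine (limn_esup (fun n => (approx_ev n p)%:E)).

Lemma measurable_ev : measurable_fun setT ev.
Proof.
apply: measurableT_comp => //; apply: measurable_fun_limn_esup => n.
by apply/measurable_EFinP; exact: measurable_approx_ev.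
Qed.

(** The cells around [t] shrink nicely, so their averages converge at every Lebesgue point of [x]
    extended by zero off [[0, 1]]. Cells may stick out of the interval; the zero extension matches
    the integral against [mu01]. *)
Lemma ev_ae x : {ae mu01 R, forall t : measurableTypeR R, ev (x, t) = x t}.
Proof.
pose I : set R := [set` `[0%R : R, 1%R]].
have mI : measurable (I : set (measurableTypeR R)) by exact: measurable_itv.
pose f : R -> R := x.
have lx : locally_integrable setT (f \_ I).
  apply: integrable_locally_restrict => //.
  have /integrableP[_ ix] := integrable_H x.
  apply/integrableP; split.
    by apply/measurable_EFinP/measurable_funTS; exact: measurable_H.
  rewrite -integral_mu01//; apply: le_lt_trans ix.
  apply: ge0_subset_integral => //.
  by apply: measurableT_comp => //; apply/measurable_EFinP; exact: measurable_H.
have := lebesgue_ae_mu01 (lebesgue_differentiation lx).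
apply: filterS2 (mu01_ae_itv R) => t t01 /(nice_lebesgue_differentiation
  nicely_shrinking_cell lx).
rewrite patchE mem_set; last by rewrite /I /= in_itv.
move=> cvt; rewrite /ev (_ : (fun n => _) = (fun n =>
    (lebesgue_measure (cell n (Num.floor (n.+1%:R * t)%R)))^-1 *
    \int[lebesgue_measure]_(y in cell n (Num.floor (n.+1%:R * t)%R))
      ((f \_ I) y)%:E)).
  by rewrite (cvg_limn_einf_sup cvt).2.
apply/funext => n; rewrite lebesgue_cell /approx_ev /cell_mean /=.
set c := cell _ _.
have mc : measurable (c : set (measurableTypeR R)) by exact: measurable_itv.
have ixc : (mu01 R).-integrable c (EFin \o x).
  by apply: integrableS (integrable_H x).
rewrite EFinM fineK ?integrable_fin_num// inver; congr (_ * _).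
  by rewrite gt_eqF// invrK.
transitivity (\int[mu01 R]_(s in c `&` I) (x s)%:E).
  have mIC : measurable (~` I : set (measurableTypeR R)) by exact: measurableC.
  rewrite (negligible_integral mIC)//; first by rewrite setDE setCK.
  have [N [mN N0 IN]] := mu01_compl_itv R.
  by apply/eqP; rewrite -measure_le0 -N0; apply: le_measure; rewrite ?inE.
rewrite integral_mu01; last exact: subIsetr.
rewrite integral_mkcondr; apply: eq_integral => s _.
by rewrite !patchE; case: ifP.
Qed.
End cell_averages.

(** * Product sigma-algebras on path spaces *)

Section path_spaces.
Context (I : Type) d (T : measurableType d).

Lemma measurable_coord (i : I) :
  measurable_fun setT (fun x : paths I T => x i).
Proof.
move=> _ A mA; rewrite setTI; apply: sub_sigma_algebra.
by exists i, A.
Qed.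

Lemma measurable_to_paths d' (S : measurableType d') (f : S -> paths I T) :
  (forall i, measurable_fun setT (fun s => f s i)) -> measurable_fun setT f.
Proof.
move=> mf; apply: (@measurability _ _ S (paths I T) setT f (@cylinders I d T)) => //.
by move=> _ [_ [i [A [mA ->]]] <-]; exact: mf.
Qed.
End path_spaces.

Section sequences_of_coordinates.
Context d (T : measurableType d).

Definition tail (x : paths nat T) : paths nat T := fun j => x j.+1.

Lemma measurable_tail : measurable_fun setT tail.
Proof.
by apply: measurable_to_paths => j; exact: (@measurable_coord _ _ _ j.+1).
Qed.

Definition box (n : nat) (A : nat -> set T) : set (paths nat T) :=
  [set x | forall j, (j < n)%N -> A j (x j)].

(** Unlike [cylinders], which constrain a single coordinate, these are stable under intersection, as
    uniqueness of measures demands. *)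
Definition boxes : set (set (paths nat T)) :=
  [set C | exists n (A : nat -> set T), (forall j, measurable (A j)) /\ C = box n A].

Lemma boxes_setI : setI_closed boxes.
Proof.
move=> _ _ [n [A [mA ->]]] [m [B [mB ->]]].
exists (maxn n m), (fun j => (if (j < n)%N then A j else setT) `&`
                             (if (j < m)%N then B j else setT)).
split; first by move=> j; apply: measurableI; case: ifP.
apply/seteqP; split => [x [xA xB] j|x xAB].
  by rewrite leq_max => _; split; case: ifPn => // jn; [exact: xA|exact: xB].
by split=> j jn; have := xAB j; rewrite leq_max jn ?orbT => /(_ isT) [].
Qed.

Lemma measurable_paths_boxes : @measurable _ (paths nat T) = <<s boxes >>.
Proof.
apply/seteqP; split.
- apply: smallest_sub; first exact: smallest_sigma_algebra.
  move=> _ [i [A [mA ->]]]; apply: sub_gen_smallest.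
  exists i.+1, (fun j => if j == i then A else setT); split.
    by move=> j; case: ifP.
  apply/seteqP; split => [x /= xA j _|x /(_ i (ltnSn i))]; last by rewrite eqxx.
  by case: eqP => [->|].
- apply: smallest_sub; first exact: sigma_algebra_measurable.
  move=> _ [n [A [mA ->]]].
  rewrite (_ : box n A = \bigcap_(j in [set j | (j < n)%N])
    ((fun x : paths nat T => x j) @^-1` A j)).
    apply: bigcap_measurableType => //.
    move=> j _; rewrite -[X in measurable X]setTI; exact: measurable_coord.
  by apply/seteqP; split => x.
Qed.

Lemma paths_measure_unique (R : realType)
    (m1 m2 : {measure set (paths nat T) -> \bar R}) :
  (m1 setT < +oo)%E ->
  (forall n A, (forall j, measurable (A j)) -> m1 (box n A) = m2 (box n A)) ->
  forall A, measurable A -> m1 A = m2 A.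
Proof.
move=> m1oo m12; apply: (measure_unique boxes (fun=> setT)) => //.
- exact: measurable_paths_boxes.
- exact: boxes_setI.
- move=> _; exists 0%N, (fun=> setT); split => //.
  by apply/seteqP; split.
- by rewrite bigcup_const.
- by move=> _ [n [A [mA ->]]]; exact: m12.
Qed.
End sequences_of_coordinates.

(** * Expectations under equality in law and under independence *)

Section laws.
Context (R : realType) d (Omega : measurableType d) (P : probability Omega R).
Local Open Scope ereal_scope.

Lemma integral_same_law d' (T : measurableType d') (X Y : Omega -> T)
    (F : T -> \bar R) :
  measurable_fun setT X -> measurable_fun setT Y -> same_law P X Y ->
  measurable_fun setT F -> (forall x, 0 <= F x) ->
  \int[P]_w F (X w) = \int[P]_w F (Y w).
Proof.
move=> mX mY XY mF F0.
pose X' : {mfun Omega >-> T} := HB.pack X (isMeasurableFun.Build _ _ _ _ _ mX).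
pose Y' : {mfun Omega >-> T} := HB.pack Y (isMeasurableFun.Build _ _ _ _ _ mY).
have tr (Z : {mfun Omega >-> T}) :
    \int[P]_w F (Z w) = \int[pushforward P Z]_x F x.
  by rewrite ge0_integral_pushforward//; exact: (@measurable_funPT _ _ _ _ Z).
rewrite (tr X') (tr Y'); apply: eq_measure_integral => A mA _.
exact: XY.
Qed.

(** Independence on rectangles makes the joint law the product of the marginals, and Tonelli splits
    the integral. The two target spaces differ because one innovation will be paired with a whole
    path. *)
Lemma integral_indep d1 d2 (T1 : measurableType d1) (T2 : measurableType d2)
    (X : Omega -> T1) (Y : Omega -> T2) (f : T1 -> \bar R) (F : T2 -> \bar R) :
  measurable_fun setT X -> measurable_fun setT Y ->
  (forall A B, measurable A -> measurable B ->
    P (X @^-1` A `&` Y @^-1` B) = P (X @^-1` A) * P (Y @^-1` B)) ->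
  measurable_fun setT f -> (forall x, 0 <= f x) ->
  measurable_fun setT F -> (forall y, 0 <= F y) ->
  \int[P]_w (f (X w) * F (Y w)) = \int[P]_w f (X w) * \int[P]_w F (Y w).
Proof.
move=> mX mY XY mf f0 mF F0.
pose Z w := (X w, Y w).
have mZ : measurable_fun setT Z by exact: measurable_fun_pair.
pose X' : {mfun Omega >-> T1} := HB.pack X (isMeasurableFun.Build _ _ _ _ _ mX).
pose Y' : {mfun Omega >-> T2} := HB.pack Y (isMeasurableFun.Build _ _ _ _ _ mY).
pose Z' : {mfun Omega >-> (T1 * T2)%type} :=
  HB.pack Z (isMeasurableFun.Build _ _ _ _ _ mZ).
pose h (p : T1 * T2) := f p.1 * F p.2.
have mh : measurable_fun setT h.
  by apply: emeasurable_funM; apply: measurableT_comp.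
have h0 p : 0 <= h p by exact: mule_ge0.
transitivity (\int[pushforward P Z']_p h p).
  by rewrite ge0_integral_pushforward.
transitivity (\int[(distribution P X' \x distribution P Y')]_p h p).
  apply: eq_measure_integral => A mA _; apply/esym.
  by apply: product_measure_unique => // B C mB mC; exact: XY.
rewrite fubini_tonelli1//= /fubini_F.
under eq_integral => x _ do rewrite /h /= ge0_integralZl//.
rewrite ge0_integralZr//; last exact: integral_ge0.
by congr (_ * _); rewrite ge0_integral_pushforward.
Qed.
End laws.

(** * Laws of the past and of the coupled past *)

Section past_laws.
Context (R : realType) d (Omega : measurableType d) (P : probability Omega R).
Variables eps eps' : int -> Omega -> Hsp R.
Hypothesis eps_iid : iid P eps.
Hypothesis eps'_copy : independent_copy P eps eps'.
Local Open Scope ereal_scope.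

Lemma measurable_past k : measurable_fun setT (past eps k).
Proof. by apply: measurable_to_paths => j; case: eps_iid => + _ _; exact. Qed.

Lemma measurable_coupled_past k m : measurable_fun setT (coupled_past eps eps' k m).
Proof.
apply: measurable_to_paths => j; rewrite /coupled_past.
have [me _ _] := eps_iid; have [me' _ _] := eps'_copy.
by case: (j < m)%N; [exact: me|exact: me'].
Qed.

Definition back (k : int) (j : nat) : int := (k - 1 - j%:Z)%R.

Lemma back_inj k : injective (back k).
Proof. by move=> i j; rewrite /back => /addrI/oppr_inj[]. Qed.

Lemma indep_back k (s : seq nat) (A : nat -> set (Hsp R)) :
  uniq s -> (forall j, measurable (A j)) ->
  P [set w | forall j, j \in s -> A j (eps (back k j) w)] =
  \prod_(j <- s) P (eps 0%R @^-1` A j).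
Proof.
move=> us mA; case: eps_iid => _ ind sl.
(* [mutually_independent] wants sets indexed by times: this inverts [back k] on its image, and its
   values elsewhere do not matter. *)
pose A' (i : int) := A (absz (k - 1 - i)%R).
have A'E j : A' (back k j) = A j.
  by rewrite /A' /back; congr A; lia.
rewrite [X in P X](_ : _ =
    [set w | forall i, i \in map (back k) s -> A' i (eps i w)]).
  rewrite ind; [|by rewrite map_inj_uniq//; exact: back_inj|by move=> i; exact: mA].
  rewrite big_map; apply: eq_bigr => j _; rewrite A'E.
  exact: sl.
apply/seteqP; split => w /= h; first by move=> _ /mapP[j js ->]; rewrite A'E; exact: h.
by move=> j js; rewrite -A'E; apply: h; exact: map_f.
Qed.

Lemma law_past_box k n A : (forall j, measurable (A j)) ->
  P (past eps k @^-1` box n A) = \prod_(0 <= j < n) P (eps 0%R @^-1` A j).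
Proof.
move=> mA; rewrite -(indep_back k (iota_uniq 0 _))// /index_iota subn0.
congr (P _); apply/seteqP; split => w /= h j; first by rewrite mem_iota => /h.
by move=> jn; apply: h; rewrite mem_iota.
Qed.

(** Formulated on two-sided paths, since the independence of the copy is an assertion about
    [path_of eps] and [path_of eps']. *)
Definition back_cylinder k (s : seq nat) (A : nat -> set (Hsp R)) :
  set (paths int (Hsp R)) := [set x | forall j, j \in s -> A j (x (back k j))].

Lemma measurable_back_cylinder k s A : (forall j, measurable (A j)) ->
  measurable (back_cylinder k s A).
Proof.
move=> mA; rewrite (_ : back_cylinder k s A = \bigcap_(j in [set j | j \in s])
    ((fun x : paths int (Hsp R) => x (back k j)) @^-1` A j)).
  apply: bigcap_measurableType => j _.
  by rewrite -[X in measurable X]setTI; exact: measurable_coord.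
by apply/seteqP; split => x.
Qed.

(** The box splits at index [m] into an event of [eps] and an event of its copy; these are
    independent, the copy has the law of [eps], and the two partial products recombine. *)
Lemma law_coupled_past_box k m n A : (forall j, measurable (A j)) ->
  P (coupled_past eps eps' k m @^-1` box n A) =
  \prod_(0 <= j < n) P (eps 0%R @^-1` A j).
Proof.
move=> mA; have [_ sl ind] := eps'_copy.
pose s1 := [seq j <- iota 0 n | (j < m)%N].
pose s2 := [seq j <- iota 0 n | ~~ (j < m)%N].
rewrite [X in P X](_ : _ = path_of eps @^-1` back_cylinder k s1 A `&`
                           path_of eps' @^-1` back_cylinder k s2 A).
  rewrite ind; [|exact: measurable_back_cylinder..].
  rewrite -sl; last exact: measurable_back_cylinder.
  have us s : uniq s -> P (path_of eps @^-1` back_cylinder k s A) =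
      \prod_(j <- s) P (eps 0%R @^-1` A j).
    by move=> ?; rewrite -(@indep_back k).
  rewrite !us ?filter_uniq ?iota_uniq// !big_filter.
  by rewrite /index_iota subn0 [RHS](bigID (fun j => (j < m)%N)).
apply/seteqP; split => [w /= h|w /= [h1 h2] j jn].
  split=> j /=; rewrite mem_filter mem_iota => /andP[jm jn]; have := h j jn;
    rewrite /coupled_past.
    by rewrite jm.
  by rewrite (negbTE jm).
rewrite /coupled_past; case: ifPn => jm; [apply: h1|apply: h2];
  by rewrite mem_filter jm mem_iota.
Qed.

Lemma law_of_boxes (X : Omega -> paths nat (Hsp R)) k :
  measurable_fun setT X ->
  (forall n A, (forall j, measurable (A j)) ->
    P (X @^-1` box n A) = \prod_(0 <= j < n) P (eps 0%R @^-1` A j)) ->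
  same_law P X (past eps k).
Proof.
move=> mX XE.
pose X' : {mfun Omega >-> paths nat (Hsp R)} :=
  HB.pack X (isMeasurableFun.Build _ _ _ _ _ mX).
pose Y' : {mfun Omega >-> paths nat (Hsp R)} :=
  HB.pack (past eps k) (isMeasurableFun.Build _ _ _ _ _ (measurable_past k)).
apply: (@paths_measure_unique _ _ _ (pushforward P X') (pushforward P Y')).
  by change (P (X @^-1` setT) < +oo); rewrite preimage_setT probability_setT ltry.
by move=> n A mA; exact: etrans (XE n A mA) (esym (law_past_box k n mA)).
Qed.

Lemma same_law_past k l : same_law P (past eps k) (past eps l).
Proof.
apply: law_of_boxes; first exact: measurable_past.
by move=> n A mA; exact: law_past_box.
Qed.

Lemma same_law_coupled_past k m l :
  same_law P (coupled_past eps eps' k m) (past eps l).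
Proof.
apply: law_of_boxes; first exact: measurable_coupled_past.
by move=> n A mA; exact: law_coupled_past_box.
Qed.

(** With [m = 0] no innovation is shared, and the coupled past is the past of the copy by
    conversion. *)
Lemma measurable_past' k : measurable_fun setT (past eps' k).
Proof. exact: (measurable_coupled_past k 0). Qed.

(* The past is distributed like its first coordinate followed by the past of
   the independent copy, whence the product. *)
Lemma integral_past_step k (f : Hsp R -> \bar R)
    (F : paths nat (Hsp R) -> \bar R) :
  measurable_fun setT f -> (forall x, 0 <= f x) ->
  measurable_fun setT F -> (forall x, 0 <= F x) ->
  \int[P]_w (f (past eps k w 0%N) * F (tail (past eps k w))) =
  \int[P]_w f (eps 1%R w) * \int[P]_w F (past eps k w).
Proof.
move=> mf f0 mF F0; have [me ind sl] := eps_iid.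
have [me' slc indc] := eps'_copy.
pose G (x : paths nat (Hsp R)) := f (x 0%N) * F (tail x).
have mG : measurable_fun setT G.
  apply: emeasurable_funM; first exact: (measurableT_comp mf (measurable_coord _)).
  exact: (measurableT_comp mF (@measurable_tail _ _)).
have G0 x : 0 <= G x by exact: mule_ge0.
rewrite -[LHS](integral_same_law (measurable_coupled_past k 1)
  (measurable_past k) (same_law_coupled_past k 1 k) mG G0).
have cE w : G (coupled_past eps eps' k 1 w) =
    f (eps (k - 1)%R w) * F (past eps' (k - 1)%R w).
  rewrite /G /coupled_past /= subr0; congr (_ * F _).
  by apply/funext => j; rewrite /tail /past /=; congr (eps' _ w); lia.
under eq_integral do rewrite cE.
rewrite integral_indep//.
- congr (_ * _).
    by apply: integral_same_law.
  apply: integral_same_law => //; first exact: measurable_past'.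
    exact: measurable_past.
  exact: (same_law_coupled_past (k - 1) 0 k).
- exact: measurable_past'.
- move=> A B mA mB.
  have := indc ((fun x => x (k - 1)%R) @^-1` A)
    ((fun x : paths int (Hsp R) => (fun j => x (back (k - 1) j)) : paths nat (Hsp R)) @^-1` B).
  apply.
    by rewrite -[X in measurable X]setTI; exact: measurable_coord.
  rewrite -[X in measurable X]setTI.
  by apply: measurable_to_paths => //= j; exact: measurable_coord.
Qed.
End past_laws.

Lemma le_poweR (R : realType) (r : R) (x y : \bar R) :
  0 <= r -> (0 <= x)%E -> (x <= y)%E -> (x `^ r <= y `^ r)%E.
Proof.
move=> r0 x0 xy; apply: gt0_ler_poweR => //; rewrite in_itv /= leey andbT//.
exact: le_trans xy.
Qed.

(** * One step of the recursion *)

Section recursion_operator.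
Variables (R : realType) (beta : R -> R -> R) (delta : Hsp R).
Hypothesis mbeta : measurable_fun [set: measurableTypeR R * measurableTypeR R]
  (fun ts => beta ts.1 ts.2).
Local Open Scope ereal_scope.

(* [z = delta + beta (e^2 h)], the relation linking [sigma_k^2] to
   [eps_(k-1)] and [sigma_(k-1)^2] *)
Definition garch_step (z e h : Hsp R) : Prop :=
  {ae mu01 R, forall t : measurableTypeR R, (z t)%:E =
    (delta t)%:E + \int[mu01 R]_s (beta t s * (e s ^+ 2 * h s))%:E}.

Lemma measurable_beta t :
  measurable_fun [set: measurableTypeR R] (beta t : measurableTypeR R -> R).
Proof. exact: (measurableT_comp mbeta (measurable_pair1 t)). Qed.

Lemma measurable_step_integrand t (e : Hsp R) (h : R -> R) :
  measurable_fun [set: measurableTypeR R] h ->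
  measurable_fun [set: measurableTypeR R]
    (fun s => (beta t s * (e s ^+ 2 * h s))%:E).
Proof.
move=> mh; apply/measurable_EFinP.
apply: measurable_funM; first exact: measurable_beta.
apply: measurable_funM => //; apply: measurable_funX; exact: measurable_H.
Qed.

(** Cauchy-Schwarz with [beta t s * e s ^+ 2] kept as one factor, whence the fourth power in
    [Kcoef]. [h] is a plain function so that a difference of two representatives can be inserted. *)
Lemma step_integrand_bound t (e : Hsp R) (h : R -> R) :
  measurable_fun [set: measurableTypeR R] h ->
  \int[mu01 R]_s `|beta t s * (e s ^+ 2 * h s)|%:E <=
  (\int[mu01 R]_s (beta t s ^+ 2 * e s ^+ 4)%:E) `^ 2^-1 *
  'N[mu01 R]_2%:E[EFin \o h].
Proof.
move=> mh; pose b s : R := (beta t s * e s ^+ 2)%R.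
have mb : measurable_fun [set: measurableTypeR R] b.
  by apply: measurable_funM; [exact: measurable_beta|
    apply: measurable_funX; exact: measurable_H].
have bE : 'N[mu01 R]_2%:E[EFin \o b] =
    (\int[mu01 R]_s (beta t s ^+ 2 * e s ^+ 4)%:E) `^ 2^-1.
  rewrite Lnorm2E; congr (_ `^ _); apply: eq_integral => s _.
  by rewrite /b exprMn -exprM.
have := cauchy_schwarz mb mh.
by rewrite bE; under eq_integral do rewrite -mulrA.
Qed.

Lemma kernel_section_ge0 t (e : Hsp R) :
  0 <= \int[mu01 R]_s (beta t s ^+ 2 * e s ^+ 4)%:E.
Proof.
by apply: integral_ge0 => s _; rewrite lee_fin mulr_ge0// ?sqr_ge0//
  -[4%N]/(2 * 2)%N exprM sqr_ge0.
Qed.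

Lemma step_integrable t (e h : Hsp R) :
  \int[mu01 R]_s (beta t s ^+ 2 * e s ^+ 4)%:E < +oo ->
  (mu01 R).-integrable setT (fun s => (beta t s * (e s ^+ 2 * h s))%:E).
Proof.
move=> kt_oo; apply/integrableP; split.
  by apply: measurable_step_integrand; exact: measurable_H.
apply: le_lt_trans (step_integrand_bound _ _ (measurable_H h)) _.
apply: lte_mul_pinfty; first exact: poweR_ge0.
  by rewrite fin_num_poweR// ge0_fin_numE// kernel_section_ge0.
exact: normH_lty.
Qed.

Lemma measurable_kernel_section (e : Hsp R) :
  measurable_fun [set: measurableTypeR R]
    (fun t => \int[mu01 R]_s (beta t s ^+ 2 * e s ^+ 4)%:E).
Proof.
apply: (@measurable_fun_fubini_tonelli_F _ _ _ _ _ (mu01 R)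
  (fun ts : measurableTypeR R * measurableTypeR R =>
    (beta ts.1 ts.2 ^+ 2 * e ts.2 ^+ 4)%:E)).
  apply/measurable_EFinP/measurable_funM; apply: measurable_funX => //.
  by apply: (measurableT_comp (measurable_H e)); exact: measurable_snd.
move=> [t s]; rewrite lee_fin mulr_ge0// ?sqr_ge0//.
by rewrite -[4%N]/(2 * 2)%N exprM sqr_ge0.
Qed.

(** Finiteness of [Kcoef beta e] makes the kernel section finite at almost every [t]. There both
    integrals are finite and may be subtracted, which cancels [delta]; the squared pointwise bound
    is then integrated in [t]. *)
Lemma garch_step_contraction z e h z' h' :
  Kcoef beta e < +oo -> garch_step z e h -> garch_step z' e h' ->
  distH z z' <= Kcoef beta e * distH h h'.
Proof.
move=> Ke_oo st st'.
pose k t := \int[mu01 R]_s (beta t s ^+ 2 * e s ^+ 4)%:E.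
have k0 t : 0 <= k t by exact: kernel_section_ge0.
have mk : measurable_fun setT k by exact: measurable_kernel_section.
have ik : (mu01 R).-integrable setT k.
  apply/integrableP; split => //; under eq_integral do rewrite gee0_abs//.
  by move: Ke_oo; apply: lty_poweRy; rewrite invr_neq0.
have aek := integrable_ae measurableT ik.
pose D := distH h h'.
have D0 : 0 <= D by exact: distH_ge0.
have Doo : D < +oo by exact: distH_lty.
have pointwise : {ae mu01 R, forall t : measurableTypeR R, setT t ->
    `|(z t - z' t)%:E| `^ 2 <= k t * D `^ 2}.
  apply: filterS3 st st' aek => t zt zt' /(_ I) kt_fin _.
  have kt : k t < +oo by rewrite -ge0_fin_numE.
  have ih := step_integrable h kt.
  have ih' := step_integrable h' kt.
  have zz' : (z t - z' t)%:E =
      \int[mu01 R]_s (beta t s * (e s ^+ 2 * (h s - h' s)))%:E.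
    rewrite EFinB zt zt' oppeD; last by rewrite fin_num_adde_defr.
    rewrite addeACA -EFinN -EFinD subrr add0e -integralB_EFin//.
    by apply: eq_integral => s _; rewrite -EFinB !mulrBr.
  have le1 : `|(z t - z' t)%:E| <= k t `^ 2^-1 * D.
    have mhh := measurable_funB (measurable_H h) (measurable_H h').
    rewrite zz'; apply: le_trans (step_integrand_bound t e mhh).
    apply: le_trans (le_abse_integral _ measurableT _) _ => //.
    exact: measurable_step_integrand.
  have := le_poweR (ler0n R 2) (abse_ge0 _) le1.
  by rewrite poweRM ?poweR_ge0// -poweRrM mulVf// poweRe1.
rewrite -/D.
have -> : Kcoef beta e * D = (\int[mu01 R]_t (k t * D `^ 2)) `^ 2^-1.
  rewrite ge0_integralZr//; last exact: poweR_ge0.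
  rewrite poweRM ?integral_ge0 ?poweR_ge0//.
  by rewrite -poweRrM mulfV// poweRe1.
rewrite /distH unlock; apply: le_poweR.
- by rewrite invr_ge0.
- by apply: integral_ge0 => t _; exact: poweR_ge0.
apply: ae_ge0_le_integral => //.
- by move=> t _; exact: poweR_ge0.
- apply: (measurableT_comp (measurable_poweR _)); apply: measurableT_comp => //.
  by apply/measurable_EFinP/measurable_funB; exact: measurable_H.
- by move=> t _; rewrite mule_ge0// poweR_ge0.
- exact: emeasurable_funM.
Qed.

(** With [delta] as the image of zero, the growth bound on the norm becomes an instance of the
    contraction. *)
Lemma garch_step0 e : garch_step delta e (zero_H R).
Proof.
apply: nearW => t; rewrite (ae_eq_integral (cst 0)) ?integral0 ?adde0//.
- by apply: measurable_step_integrand; exact: measurable_H.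
- by apply: filterS (zero_HE R) => s /= -> _; rewrite !mulr0.
Qed.

Lemma normH_garch_step z e h : Kcoef beta e < +oo -> garch_step z e h ->
  normH z <= normH delta + Kcoef beta e * normH h.
Proof.
move=> Ke st; rewrite -(distH0 z) -(distH0 delta) -(distH0 h) addeC.
apply: le_trans (distH_triangle delta z (zero_H R)) _.
by rewrite leeD2r// garch_step_contraction//; exact: garch_step0.
Qed.

(** * Measurability in the random element *)

Section measurability.
Context d (T : measurableType d).

Lemma measurable_ev_comp (X : T -> Hsp R) : measurable_fun setT X ->
  measurable_fun [set: T * measurableTypeR R] (fun p => ev (X p.1, p.2)).
Proof.
move=> mX; apply: (measurableT_comp (@measurable_ev R)).
apply: measurable_fun_pair; last exact: measurable_snd.
exact: (measurableT_comp mX measurable_fst).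
Qed.

(** Replacing the representatives by [ev] leaves each integral unchanged and makes the integrand
    jointly measurable, so that Tonelli applies. *)
Lemma measurable_distH (X Y : T -> Hsp R) :
  measurable_fun setT X -> measurable_fun setT Y ->
  measurable_fun setT (fun w => distH (X w) (Y w)).
Proof.
move=> mX mY.
rewrite (_ : (fun w => _) = (fun w =>
  (\int[mu01 R]_t ((ev (X w, t) - ev (Y w, t)) ^+ 2)%:E) `^ 2^-1)); last first.
  apply/funext => w; rewrite /distH Lnorm2E; congr (_ `^ _).
  have mev (x : Hsp R) : measurable_fun [set: measurableTypeR R] (fun t => ev (x, t)).
    exact: (measurableT_comp (@measurable_ev R) (measurable_pair1 x)).
  apply: ae_eq_integral => //.
  - by apply/measurable_EFinP/measurable_funX/measurable_funB;
      exact: measurable_H.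
  - by apply/measurable_EFinP/measurable_funX/measurable_funB.
  - by apply: filterS2 (ev_ae (X w)) (ev_ae (Y w)) => t /= -> ->.
apply: (measurableT_comp (measurable_poweR _)).
apply: (@measurable_fun_fubini_tonelli_F _ _ _ _ _ (mu01 R)
  (fun p : T * measurableTypeR R => ((ev (X p.1, p.2) - ev (Y p.1, p.2)) ^+ 2)%:E)).
  by apply/measurable_EFinP/measurable_funX/measurable_funB;
    exact: measurable_ev_comp.
by move=> p; rewrite lee_fin sqr_ge0.
Qed.

Lemma measurable_normH (X : T -> Hsp R) : measurable_fun setT X ->
  measurable_fun setT (fun w => normH (X w)).
Proof.
move=> mX; under eq_fun do rewrite -distH0.
by apply: measurable_distH.
Qed.

Lemma measurable_Kcoef (X : T -> Hsp R) : measurable_fun setT X ->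
  measurable_fun setT (fun w => Kcoef beta (X w)).
Proof.
move=> mX; apply: (measurableT_comp (measurable_poweR _)).
pose G (q : (T * measurableTypeR R) * measurableTypeR R) : \bar R :=
  (beta q.1.2 q.2 ^+ 2 * ev (X q.1.1, q.2) ^+ 4)%:E.
have G0 q : 0 <= G q.
  by rewrite lee_fin mulr_ge0// ?sqr_ge0// -[4%N]/(2 * 2)%N exprM sqr_ge0.
have mG : measurable_fun setT G.
  apply/measurable_EFinP/measurable_funM; apply: measurable_funX.
    apply: (measurableT_comp mbeta
      (g := fun q : (T * measurableTypeR R) * measurableTypeR R => (q.1.2, q.2))).
    apply: measurable_fun_pair; last exact: measurable_snd.
    exact: (measurableT_comp measurable_snd measurable_fst).
  apply: (measurableT_comp (measurable_ev_comp mX)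
    (g := fun q : (T * measurableTypeR R) * measurableTypeR R => (q.1.1, q.2))).
  apply: measurable_fun_pair; last exact: measurable_snd.
  exact: (measurableT_comp measurable_fst measurable_fst).
pose F := fubini_F (mu01 R) G.
have F0 p : 0 <= F p by exact: integral_ge0.
have mF : measurable_fun setT F by exact: measurable_fun_fubini_tonelli_F.
rewrite (_ : (fun w => _) = fubini_F (mu01 R) F).
  exact: measurable_fun_fubini_tonelli_F.
apply/funext => w; apply: eq_integral => t _.
apply: ae_eq_integral; first exact: measurableT.
- apply/measurable_EFinP/measurable_funM; apply: measurable_funX;
  [exact: measurable_beta|exact: measurable_H].
- exact: (measurableT_comp mG (measurable_pair1 (w, t))).
- by apply: filterS (ev_ae (X w)) => s eX _; rewrite /G /= eX.
Qed.

(* The pointwise recursion only makes sense up to null sets, so it is read off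
   the jointly measurable version [ev]. *)
Lemma measurable_garch_step (Z X Y : T -> Hsp R) :
  measurable_fun setT Z -> measurable_fun setT X -> measurable_fun setT Y ->
  measurable [set w | garch_step (Z w) (X w) (Y w)].
Proof.
move=> mZ mX mY.
pose Q := ((T * measurableTypeR R) * measurableTypeR R)%type.
pose G (q : Q) : \bar R :=
  (beta q.1.2 q.2 * (ev (X q.1.1, q.2) ^+ 2 * ev (Y q.1.1, q.2)))%:E.
have m13 : measurable_fun setT (fun q : Q => (q.1.1, q.2)).
  apply: measurable_fun_pair; last exact: measurable_snd.
  exact: (measurableT_comp measurable_fst measurable_fst).
have m23 : measurable_fun setT (fun q : Q => (q.1.2, q.2)).
  apply: measurable_fun_pair; last exact: measurable_snd.
  exact: (measurableT_comp measurable_snd measurable_fst).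
have mG : measurable_fun setT G.
  apply/measurable_EFinP/measurable_funM.
    exact: (measurableT_comp mbeta m23).
  apply: measurable_funM.
    by apply: measurable_funX; exact: (measurableT_comp (measurable_ev_comp mX) m13).
  exact: (measurableT_comp (measurable_ev_comp mY) m13).
pose u (p : T * measurableTypeR R) : \bar R := (ev (Z p.1, p.2))%:E.
(* The integrand has no fixed sign: Tonelli is applied to its positive and negative parts, whose
   difference is the integral by definition. *)
pose v (p : T * measurableTypeR R) : \bar R := (delta p.2)%:E +
  (fubini_F (mu01 R) G^\+ p - fubini_F (mu01 R) G^\- p).
have mu_ : measurable_fun setT u by apply/measurable_EFinP; exact: measurable_ev_comp.
have mv : measurable_fun setT v.
  apply: emeasurable_funD.
    apply/measurable_EFinP; apply: (measurableT_comp (measurable_H delta)).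
    exact: measurable_snd.
  apply: emeasurable_funB; apply: measurable_fun_fubini_tonelli_F => //.
    exact: measurable_funepos.
  exact: measurable_funeneg.
have mN := measurable_neqe measurableT mu_ mv.
rewrite setTI in mN.
have mxs := measurable_fun_xsection (mu01 R) mN.
(* The recursion holds at [w] exactly when the section at [w] of the disagreement set is null, and
   the measure of a section is measurable in [w]. *)
rewrite (_ : [set w | _] = (fun w => mu01 R (xsection [set p | u p != v p] w)) @^-1` [set 0]).
  by rewrite -[X in measurable X]setTI; apply: mxs.
have stepE w t : u (w, t) = v (w, t) <-> (ev (Z w, t))%:E = (delta t)%:E +
    \int[mu01 R]_s (beta t s * (X w s ^+ 2 * Y w s))%:E.
  rewrite /u /v /=.
  suff -> : \int[mu01 R]_s (beta t s * (X w s ^+ 2 * Y w s))%:E =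
    fubini_F (mu01 R) G^\+ (w, t) - fubini_F (mu01 R) G^\- (w, t) by [].
  transitivity (\int[mu01 R]_s G ((w, t), s)).
    apply: ae_eq_integral; first exact: measurableT.
    - by apply: measurable_step_integrand; exact: measurable_H.
    - exact: (measurableT_comp mG (measurable_pair1 (w, t))).
    - by apply: filterS2 (ev_ae (X w)) (ev_ae (Y w)) => s eX eY _;
        rewrite /G /= eX eY.
  rewrite [LHS]integralE /fubini_F.
  congr (_ - _); apply: eq_integral => s _; first by rewrite !funeposE.
  by rewrite !funenegE.
have mxsw w := measurable_xsection w mN.
apply/seteqP; split => w /= hw.
  have : (mu01 R).-negligible (xsection [set p | u p != v p] w).
    have : {ae mu01 R, forall t : measurableTypeR R, u (w, t) = v (w, t)}.
      by apply: filterS2 hw (ev_ae (Z w)) => t zt et; apply/stepE; rewrite et.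
    by apply: negligibleS => t /xsectionP /= /eqP.
  by move/negligibleP; apply.
have : {ae mu01 R, forall t : measurableTypeR R, u (w, t) = v (w, t)}.
  exists (xsection [set p | u p != v p] w); split => // t /= nt.
  by apply/xsectionP => /=; apply/eqP.
by apply: filterS2 (ev_ae (Z w)) => t et /stepE; rewrite et.
Qed.
End measurability.
End recursion_operator.

(* A stationary [U] with [U <= a + W * U o theta] and [E W = b < 1] is
   integrable without any a priori moment: iterating from a constant [L] bounds
   [min U M] by [a / (1 - b) + b^n L + M 1_(U o theta^n > L)] in mean, and
   [n], then [L], may be chosen according to [M]. *)
Section affine_recursion.
Import numFieldNormedType.Exports.
Context (R : realType) d (T : measurableType d) (Q : probability T R).
Local Open Scope ereal_scope.
Variables (theta : T -> T) (W U : T -> \bar R) (a b : R).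
Hypothesis mtheta : measurable_fun setT theta.
Hypothesis Qtheta : forall A, measurable A -> Q (theta @^-1` A) = Q A.
Hypotheses (mW : measurable_fun setT W) (W0 : forall x, 0 <= W x).
Hypotheses (mU : measurable_fun setT U) (U0 : forall x, 0 <= U x).
Hypothesis U_oo : forall x, U x < +oo.
Hypotheses (a0 : (0 <= a)%R) (b0 : (0 <= b)%R) (b1 : (b < 1)%R).
Hypothesis integral_W : forall F : T -> \bar R, measurable_fun setT F ->
  (forall x, 0 <= F x) -> \int[Q]_x (W x * F (theta x)) = b%:E * \int[Q]_x F x.
Hypothesis U_le : {ae Q, forall x, U x <= a%:E + W x * U (theta x)}.

Let iterate (L : R) := fix A (n : nat) (x : T) : \bar R :=
  if n is m.+1 then a%:E + W x * A m (theta x) else L%:E.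

Let iterate_ge0 L n x : (0 <= L)%R -> 0 <= iterate L n x.
Proof.
move=> L0; elim: n x => [|n IH] x /=; first by rewrite lee_fin.
by rewrite adde_ge0 ?lee_fin// mule_ge0.
Qed.

Let measurable_iterate L n : measurable_fun setT (iterate L n).
Proof.
elim: n => [|n IH] /=; first exact: measurable_cst.
apply: emeasurable_funD; first exact: measurable_cst.
apply: emeasurable_funM => //; exact: (measurableT_comp IH mtheta).
Qed.

(** In mean, the iteration is [u |-> a + b u] started from [L], with fixed point [a / (1 - b)]. *)
Let integral_iterate L n : (0 <= L)%R ->
  \int[Q]_x iterate L n x <= (a / (1 - b) + b ^+ n * L)%:E.
Proof.
move=> L0; have b1' : (0 < 1 - b)%R by rewrite subr_gt0.
elim: n => [|n IH] /=.
  rewrite integral_cst// [X in _ * X]probability_setT mule1 lee_fin.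
  by rewrite expr0 mul1r lerDr divr_ge0// ltW.
rewrite ge0_integralD//=; first last.
- apply: emeasurable_funM => //.
  exact: (measurableT_comp (measurable_iterate L n) mtheta).
- by move=> x _; rewrite mule_ge0// iterate_ge0.
rewrite integral_cst// [X in _ * X]probability_setT mule1.
rewrite integral_W//; last by move=> x; exact: iterate_ge0.
apply: (@le_trans _ _ (a%:E + b%:E * (a / (1 - b) + b ^+ n * L)%:E)).
  by rewrite leeD2l// lee_wpmul2l// lee_fin.
rewrite -EFinM -EFinD lee_fin le_eqVlt; apply/orP; left; apply/eqP.
rewrite exprS; field; exact: lt0r_neq0.
Qed.

Let ae_theta (S : T -> Prop) : {ae Q, forall x, S x} ->
  {ae Q, forall x, S (theta x)}.
Proof.
case=> N [mN N0 SN]; exists (theta @^-1` N); split.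
- by rewrite -[X in measurable X]setTI; exact: mtheta.
- by rewrite Qtheta.
- by move=> x /= nS; exact: SN.
Qed.

Let iter_theta n : measurable_fun setT (iter n theta) /\
  forall A, measurable A -> Q (iter n theta @^-1` A) = Q A.
Proof.
elim: n => [|n [mn Qn]]; first by split; [exact: measurable_id|].
split=> [|A mA]; first exact: (measurableT_comp mtheta mn).
transitivity (Q (theta @^-1` A)); last exact: Qtheta.
apply: (Qn (theta @^-1` A)).
by rewrite -[X in measurable X]setTI; exact: mtheta.
Qed.

(** Domination by the iterates needs their starting value [L] to be at least [U] at the [n]-th
    shift; the second alternative records where this fails. *)
Let U_le_iterate L n : {ae Q, forall x,
  U x <= iterate L n x \/ L%:E < U (iter n theta x)}.
Proof.
elim: n => [|n IH].
  by apply: aeW => x /=; case: (leP (U x) L%:E) => ?; [left|right].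
apply: filterS2 U_le (ae_theta IH) => x Ux [Utx|LU]; [left|right] => /=.
  by apply: (le_trans Ux); rewrite leeD2l// lee_wpmul2l.
by rewrite -iterSr in LU.
Qed.

Let tail_set L := [set x | L%:E < U x].

Let measurable_tail_set L : measurable (tail_set L).
Proof. by rewrite -[X in measurable X]setTI; exact: emeasurable_fun_o_infty. Qed.

(** Truncation caps the contribution of the exceptional event at [M], and invariance gives this
    event a probability independent of [n]. *)
Let integral_min (M L : R) n : (0 <= M)%R -> (0 <= L)%R ->
  \int[Q]_x mine (U x) M%:E <=
  (a / (1 - b) + b ^+ n * L)%:E + M%:E * Q (tail_set L).
Proof.
move=> M0 L0; have [mn Qn] := iter_theta n.
pose E := iter n theta @^-1` tail_set L.
have mE : measurable E by rewrite -[X in measurable X]setTI; exact: mn.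
apply: (@le_trans _ _ (\int[Q]_x (iterate L n x + M%:E * (\1_E x)%:E))).
  apply: ae_ge0_le_integral => //.
  - by move=> x _; rewrite le_min U0 lee_fin.
  - exact: measurable_mine.
  - by move=> x _; rewrite adde_ge0 ?iterate_ge0// mule_ge0 ?lee_fin.
  - apply: emeasurable_funD => //; apply: emeasurable_funM => //.
    by apply/measurable_EFinP; exact: measurable_indic.
  apply: filterS (U_le_iterate L n) => x [Ux|LU] _.
    rewrite ge_min; apply/orP; left; apply: (le_trans Ux).
    by rewrite leeDl// mule_ge0 ?lee_fin.
  rewrite ge_min; apply/orP; right; rewrite indicE mem_set//= mule1 leeDr//.
  exact: iterate_ge0.
rewrite ge0_integralD//; first last.
- apply: emeasurable_funM => //.
  by apply/measurable_EFinP; exact: measurable_indic.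
- by move=> x _; rewrite mule_ge0 ?lee_fin.
- by move=> x _; exact: iterate_ge0.
apply: leeD; first exact: integral_iterate.
rewrite ge0_integralZl//; last first.
  by apply/measurable_EFinP; exact: measurable_indic.
rewrite integral_indic// setIT; apply: lee_wpmul2l; first by rewrite lee_fin.
by rewrite le_eqVlt; apply/orP; left; apply/eqP; exact: Qn.
Qed.

Let tail_set_cvg0 : Q (tail_set n%:R) @[n --> \oo] --> 0.
Proof.
rewrite -(@measure0 _ _ _ Q).
have -> : set0 = \bigcap_n tail_set n%:R.
  apply/esym/seteqP; split => // x xU.
  have Ux : U x \is a fin_num by rewrite ge0_fin_numE.
  have := xU (Num.bound (fine (U x))) I.
  rewrite /tail_set /= -(fineK Ux) lte_fin => /ltW.
  by rewrite leNgt archi_boundP// fine_ge0.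
apply: nonincreasing_cvg_mu => //.
- by rewrite (le_lt_trans (probability_le1 _ _))// ltry.
- exact: bigcapT_measurable.
- move=> m n mn; apply/subsetPset => x; rewrite /tail_set /=.
  by apply: le_lt_trans; rewrite lee_fin ler_nat.
Qed.

Let integral_min_le (M : nat) :
  \int[Q]_x mine (U x) M%:R%:E <= (a / (1 - b) + 2)%:E.
Proof.
(* [L] depends on [M] only, and [n] is then taken large for this [L]. Each of the two errors is at
   most one, whence the 2 in the bound, which is uniform in [M]. *)
have [L ML] : exists L : nat, M%:R%:E * Q (tail_set L%:R) <= 1.
  have : M%:R%:E * Q (tail_set n%:R) @[n --> \oo] --> M%:R%:E * 0.
    by apply: cvgeZl => //; exact: tail_set_cvg0.
  rewrite mule0 => cv; apply: contrapT => /forallNP ML.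
  suff : (1 : \bar R) <= 0 by rewrite lee_fin ler10.
  by apply: cvge_ge cv; apply: nearW => n; apply/ltW; rewrite ltNge; apply/negP.
have [n bn] : exists n, (b ^+ n * L%:R <= 1)%R.
  have b_lt1 : (`|b| < 1)%R by rewrite ger0_norm.
  have /cvgr0_norm_le/(_ _ ltr01)[n _ /(_ n (leqnn n))] :=
    cvg_geometric (L%:R : R) b_lt1.
  by move=> /= /ler_normlW; rewrite mulrC => bn; exists n.
apply: (le_trans (integral_min n (ler0n _ M) (ler0n _ L))).
apply: (@le_trans _ _ ((a / (1 - b) + b ^+ n * L%:R)%:E + 1)).
  by rewrite leeD2l.
by rewrite -EFinD lee_fin; lra.
Qed.

Lemma affine_recursion_integrable : \int[Q]_x U x < +oo.
Proof.
suff : \int[Q]_x U x <= (a / (1 - b) + 2)%:E by move/le_lt_trans; apply; rewrite ltry.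
have nd x : {homo (fun n : nat => mine (U x) n%:R%:E) : m n / (m <= n)%N >-> m <= n}.
  by move=> m n mn; rewrite le_min ge_min lexx /= ge_min lee_fin ler_nat mn orbT.
have cvU x : mine (U x) n%:R%:E @[n --> \oo] --> U x.
  apply: cvg_near_cst; exists (Num.bound (fine (U x))) => // n /= Un.
  apply/min_idPl; have Ux : U x \is a fin_num by rewrite ge0_fin_numE.
  rewrite -(fineK Ux) lee_fin; apply: (@le_trans _ _ (Num.bound (fine (U x)))%:R).
    by apply/ltW/archi_boundP; rewrite fine_ge0.
  by rewrite ler_nat.
have cv : \int[Q]_x mine (U x) n%:R%:E @[n --> \oo] -->
    \int[Q]_x limn (fun n => mine (U x) n%:R%:E).
  apply: cvg_monotone_convergence => //.
  - by move=> n; exact: measurable_mine.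
  - by move=> n x _; rewrite le_min U0 lee_fin ler0n.
rewrite (eq_integral U) in cv; last by move=> x _; exact/cvg_lim.
by apply: cvge_le cv; apply: nearW => n; exact: integral_min_le.
Qed.
End affine_recursion.

(** * Moment of the stationary solution and the coupling bound *)

Section stationary_solution.
Variables (R : realType) (d : measure_display) (Omega : measurableType d).
Variable P : probability Omega R.
Variables eps eps' : int -> Omega -> Hsp R.
Variables (delta : Hsp R) (beta : R -> R -> R) (alpha : R).
Variables (y : int -> Omega -> L0 R) (sigma2 : int -> Omega -> Hsp R).
Variable g : paths nat (Hsp R) -> Hsp R.
Hypothesis eps_iid : iid P eps.
Hypothesis eps'_copy : independent_copy P eps eps'.
Hypothesis mbeta : measurable_fun
  [set: measurableTypeR R * measurableTypeR R] (fun ts => beta ts.1 ts.2).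
Hypothesis alpha_gt0 : (0 < alpha)%R.
Hypothesis EK_lt1 : (\int[P]_w (Kcoef beta (eps 1%R w) `^ alpha) < 1)%E.
Hypothesis sol : solution P eps delta beta y sigma2.
Hypothesis mg : measurable_fun setT g.
Hypothesis sigma2E : forall k, {ae P, forall w, sigma2 k w = g (past eps k w)}.
Local Open Scope ereal_scope.

(** Equality of laws compares measurable events only; this is where the measurability of the
    recursion is spent. *)
Lemma ae_same_law d' (T : measurableType d') (X Y : Omega -> T) (S : set T) :
  measurable_fun setT X -> measurable_fun setT Y -> same_law P X Y ->
  measurable S -> {ae P, forall w, S (Y w)} -> {ae P, forall w, S (X w)}.
Proof.
move=> mX mY XY mS aeS.
have mpre (Z : Omega -> T) : measurable_fun setT Z -> measurable (Z @^-1` (~` S)).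
  by move=> mZ; rewrite -[X in measurable X]setTI; apply: mZ => //; exact: measurableC.
have PY : P (Y @^-1` (~` S)) = 0.
  by apply/negligibleP; [exact: mpre|exact: negligibleS aeS].
exists (X @^-1` (~` S)); split => //; first exact: mpre.
by rewrite XY//; exact: measurableC.
Qed.

Lemma ae_distribution d' (T : measurableType d') (X : {mfun Omega >-> T})
    (S : set T) : measurable S -> {ae P, forall w, S (X w)} ->
  {ae distribution P X, forall x, S x}.
Proof.
move=> mS aeS; exists (~` S); split => //; first exact: measurableC.
rewrite /distribution /pushforward /=; apply/negligibleP => //.
rewrite -[X in measurable X]setTI; apply: (@measurable_funPT _ _ _ _ X) => //.
exact: measurableC.
Qed.

Lemma tail_past k w : tail (past eps k w) = past eps (k - 1) w.
Proof. by apply/funext => j; rewrite /tail /past; congr (eps _ w); lia. Qed.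

Lemma tail_coupled_past k m w :
  tail (coupled_past eps eps' k m.+1 w) = coupled_past eps eps' (k - 1) m w.
Proof.
apply/funext => j; rewrite /tail /coupled_past ltnS.
by congr (if _ then _ else _); [congr (eps _ w)|congr (eps' _ w)]; lia.
Qed.

Lemma solution_step k :
  {ae P, forall w, garch_step beta delta (sigma2 k w) (eps (k - 1) w) (sigma2 (k - 1) w)}.
Proof.
have [_ _ sol_k] := sol.
apply: filterS2 (sol_k k) (sol_k (k - 1)%R) => w [_ _ sk] [s0 yE _].
apply: filterS sk => t ->; congr (_ + _).
apply: ae_eq_integral; first exact: measurableT.
- apply/measurable_EFinP/measurable_funM; first exact: measurable_beta.
  apply: measurable_funX.
  exact: (@measurable_funPT _ _ _ _ (repr (y (k - 1)%R w))).
- by apply: measurable_step_integrand => //; exact: measurable_H.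
- apply: filterS2 yE s0 => s -> s0 _.
  by rewrite exprMn sqr_sqrtr.
Qed.

(** The recursion as a property of one path, free of the time and of [sigma2], so that it depends on
    the law of the path alone. *)
Definition step_paths : set (paths nat (Hsp R)) :=
  [set x | garch_step beta delta (g x) (x 0%N) (g (tail x))].

Lemma measurable_step_paths : measurable step_paths.
Proof.
apply: measurable_garch_step => //; first exact: measurable_coord.
exact: (measurableT_comp mg (@measurable_tail _ _)).
Qed.

Lemma past_step k : {ae P, forall w, step_paths (past eps k w)}.
Proof.
apply: filterS3 (solution_step k) (sigma2E k) (sigma2E (k - 1)%R) => w + e1 e2.
by rewrite e1 e2 /step_paths /= tail_past /past subr0.
Qed.

Lemma coupled_past_step k m :
  {ae P, forall w, step_paths (coupled_past eps eps' k m w)}.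
Proof.
apply: (ae_same_law (Y := past eps k)) measurable_step_paths (past_step k).
- exact: (measurable_coupled_past eps_iid eps'_copy).
- exact: (measurable_past eps_iid).
- exact: (same_law_coupled_past eps_iid eps'_copy).
Qed.

Definition EKalpha : R := fine (\int[P]_w (Kcoef beta (eps 1%R w) `^ alpha)).

Lemma integral_K_ge0 : 0 <= \int[P]_w (Kcoef beta (eps 1%R w) `^ alpha).
Proof. by apply: integral_ge0 => w _; exact: poweR_ge0. Qed.

Lemma EKalphaE : \int[P]_w (Kcoef beta (eps 1%R w) `^ alpha) = EKalpha%:E.
Proof.
rewrite fineK// ge0_fin_numE ?integral_K_ge0//.
by apply: lt_trans EK_lt1 _; rewrite ltry.
Qed.

Lemma EKalpha_ge0 : (0 <= EKalpha)%R.
Proof. by rewrite fine_ge0// integral_K_ge0. Qed.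

Lemma EKalpha_lt1 : (EKalpha < 1)%R.
Proof. by rewrite -lte_fin -EKalphaE. Qed.

Lemma measurable_Kalpha :
  measurable_fun setT (fun x : Hsp R => Kcoef beta x `^ alpha).
Proof.
apply: (measurableT_comp (measurable_poweR _)).
exact: (@measurable_Kcoef _ _ mbeta _ _ id).
Qed.

Lemma Kcoef_lty k : {ae P, forall w, Kcoef beta (eps k w) < +oo}.
Proof.
have [me _ sl] := eps_iid.
have K1 : {ae P, forall w, [set x : Hsp R | Kcoef beta x < +oo] (eps 1%R w)}.
  have iK : P.-integrable setT (fun w => Kcoef beta (eps 1%R w) `^ alpha).
    apply/integrableP; split.
      exact: (measurableT_comp measurable_Kalpha (me 1%R)).
    under eq_integral do rewrite gee0_abs ?poweR_ge0//.
    by rewrite EKalphaE ltry.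
  apply: filterS (integrable_ae measurableT iK) => w /(_ I) /= Kfin.
  apply: (@lty_poweRy _ _ alpha); first exact: lt0r_neq0.
  by rewrite ltey_eq Kfin.
apply: (ae_same_law (me k) (me 1%R) (sl k 1%R) _ K1).
rewrite -[X in measurable X]setTI; apply: emeasurable_fun_infty_o => //.
exact: (@measurable_Kcoef _ _ mbeta _ _ id).
Qed.

Definition sigma_norm (x : paths nat (Hsp R)) : \bar R := normH (g x) `^ alpha.

Lemma measurable_sigma_norm : measurable_fun setT sigma_norm.
Proof.
apply: (measurableT_comp (measurable_poweR _)); exact: measurable_normH.
Qed.

Lemma sigma_norm_ge0 x : 0 <= sigma_norm x.
Proof. exact: poweR_ge0. Qed.

(** Either [v] is at least [rho * (u + v)] or [u] is at least [(1 - rho) * (u + v)], which treats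
    every positive [alpha] alike. The weight on [v] tends to one as [rho] does, so a strict
    contraction survives. *)
Lemma poweR_add_le (rho : R) (u v : \bar R) : (0 < rho < 1)%R ->
  0 <= u -> u < +oo -> 0 <= v -> v < +oo ->
  (u + v) `^ alpha <=
  ((1 - rho)^-1 `^ alpha)%:E * u `^ alpha + (rho^-1 `^ alpha)%:E * v `^ alpha.
Proof.
move=> /andP[rho0 rho1] u0 uoo v0 voo.
have rho1' : (0 < 1 - rho)%R by rewrite subr_gt0.
have : u \is a fin_num by rewrite ge0_fin_numE.
have : v \is a fin_num by rewrite ge0_fin_numE.
move: u v u0 v0 {uoo voo} => [u| |] [v| |]//; rewrite !lee_fin => u0 v0 _ _.
rewrite -!powRM ?invr_ge0 ?(ltW rho0) ?(ltW rho1')//.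
have [uv|uv] := leP (rho * (u + v))%R v.
  apply: (@le_trans _ _ ((rho^-1 * v) `^ alpha)%R); last by rewrite lerDr powR_ge0.
  apply: ge0_ler_powR; first exact: ltW.
  - by rewrite nnegrE addr_ge0.
  - by rewrite nnegrE mulr_ge0// invr_ge0 ltW.
  - by rewrite ler_pdivlMl.
apply: (@le_trans _ _ (((1 - rho)^-1 * u) `^ alpha)%R); last by rewrite lerDl powR_ge0.
apply: ge0_ler_powR; first exact: ltW.
- by rewrite nnegrE addr_ge0.
- by rewrite nnegrE mulr_ge0// invr_ge0 ltW.
- by rewrite ler_pdivlMl// mulrBl mul1r lerBlDr lerD2l ltW.
Qed.

Let past0 : {mfun Omega >-> paths nat (Hsp R)} :=
  HB.pack (past eps 0) (isMeasurableFun.Build _ _ _ _ _ (measurable_past eps_iid 0)).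

Lemma sigma_norm_integrable : \int[P]_w sigma_norm (past eps 0 w) < +oo.
Proof.
(* Any [q] in []EKalpha, 1[] would do: [rho] is chosen so that [rho^-1] to the power [alpha] is
   [q^-1], and the weight [W] then has mean [EKalpha / q < 1]. *)
pose q : R := ((1 + EKalpha) / 2)%R.
have a0 := EKalpha_ge0; have a1 := EKalpha_lt1.
have q0 : (0 < q)%R by rewrite /q; lra.
have q1 : (q < 1)%R by rewrite /q; lra.
pose rho : R := (q `^ alpha^-1)%R.
have rho0 : (0 < rho)%R by rewrite powR_gt0.
have rho1 : (rho < 1)%R.
  have := @gt0_ltr_powR R alpha^-1 _ q 1%R _ _ q1.
  by rewrite powR1; apply; rewrite ?invr_gt0 ?nnegrE// ltW.
have rhoE : (rho^-1 `^ alpha = q^-1)%R.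
  by rewrite /rho -powRN -powRrM mulNr mulVf ?lt0r_neq0// powR_inv1// ltW.
pose a : R := ((1 - rho)^-1 `^ alpha * fine (normH delta) `^ alpha)%R.
pose W (x : paths nat (Hsp R)) := (q^-1)%R%:E * Kcoef beta (x 0%N) `^ alpha.
have mK0 : measurable_fun setT
    (fun x : paths nat (Hsp R) => Kcoef beta (x 0%N) `^ alpha).
  exact: (measurableT_comp measurable_Kalpha (measurable_coord _)).
have q0' : 0 <= (q^-1)%R%:E by rewrite lee_fin invr_ge0 ltW.
have pull F : measurable_fun setT F -> (forall x, 0 <= F x) ->
    \int[distribution P past0]_x F x = \int[P]_w F (past eps 0 w).
  by move=> mF F0; rewrite ge0_integral_pushforward//; exact: measurable_past.
rewrite -pull; [|exact: measurable_sigma_norm|exact: sigma_norm_ge0].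
apply: (@affine_recursion_integrable _ _ _ (distribution P past0) (@tail _ _) W
  sigma_norm a (EKalpha / q)).
- exact: measurable_tail.
- move=> A mA.
  transitivity (P (past eps (0 - 1)%R @^-1` A)).
    by congr (P _); apply/seteqP; split => w /=; rewrite tail_past.
  exact: (same_law_past eps_iid).
- by apply: emeasurable_funM.
- by move=> x; rewrite mule_ge0// poweR_ge0.
- exact: measurable_sigma_norm.
- exact: sigma_norm_ge0.
- by move=> x; apply: poweR_lty; exact: normH_lty.
- by rewrite mulr_ge0// powR_ge0.
- by rewrite divr_ge0// ltW.
- by rewrite ltr_pdivrMr// mul1r /q; lra.
- move=> F mF F0; rewrite !pull//; first last.
  + by move=> x; rewrite !mule_ge0// poweR_ge0.
  + apply: emeasurable_funM; first exact: emeasurable_funM.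
    exact: (measurableT_comp mF (@measurable_tail _ _)).
  rewrite /W; under eq_integral do rewrite -muleA.
  rewrite ge0_integralZl//; first last.
  + by move=> w _; rewrite mule_ge0// poweR_ge0.
  + apply: emeasurable_funM.
      exact: (measurableT_comp mK0 (measurable_past eps_iid 0)).
    exact: (measurableT_comp (measurableT_comp mF (@measurable_tail _ _))
      (measurable_past eps_iid 0)).
  rewrite (integral_past_step eps_iid eps'_copy 0 measurable_Kalpha)//; last first.
    by move=> x; exact: poweR_ge0.
  by rewrite EKalphaE muleA -EFinM [(q^-1 * _)%R]mulrC.
(* The affine inequality is wanted almost surely on the path space under the law of the past, hence
   the detour through a measurable event. *)
pose S := [set x : paths nat (Hsp R) | step_paths x /\ Kcoef beta (x 0%N) < +oo].
have mS : measurable S.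
  apply: measurableI; first exact: measurable_step_paths.
  rewrite -[X in measurable X]setTI; apply: emeasurable_fun_infty_o => //.
  exact: (measurable_Kcoef mbeta (measurable_coord _)).
have aeS : {ae P, forall w, S (past eps 0 w)}.
  by apply: filterS2 (past_step 0) (Kcoef_lty (0 - 1 - 0%:Z)%R) => w; split.
apply: filterS (ae_distribution (X := past0) mS aeS) => x [xstep Kx].
apply: (@le_trans _ _ ((normH delta + Kcoef beta (x 0%N) * normH (g (tail x))) `^ alpha)).
  apply: le_poweR; [exact: ltW|exact: normH_ge0|].
  exact: normH_garch_step Kx xstep.
have Kx0 : 0 <= Kcoef beta (x 0%N) by exact: poweR_ge0.
have rho01 : (0 < rho < 1)%R by rewrite rho0.
apply: le_trans (poweR_add_le rho01 (normH_ge0 _) (normH_lty _) _ _) _.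
- by rewrite mule_ge0// normH_ge0.
- apply: lte_mul_pinfty => //; first by rewrite ge0_fin_numE.
  exact: normH_lty.
have aE : a%:E = ((1 - rho)^-1 `^ alpha)%:E * normH delta `^ alpha.
  have dfin : normH delta \is a fin_num.
    by rewrite ge0_fin_numE ?normH_ge0// normH_lty.
  by rewrite /a -{2}(fineK dfin).
by rewrite aE; apply: leeD2l; rewrite /W rhoE poweRM ?normH_ge0// muleA.
Qed.

(* Iterating the contraction [m] times produces the products
   [K(x_0)^alpha ... K(x_(m-1))^alpha] in front of the norm at time [k - m]. *)
Fixpoint weighted (m : nat) (x : paths nat (Hsp R)) : \bar R :=
  if m is n.+1 then Kcoef beta (x 0%N) `^ alpha * weighted n (tail x)
  else sigma_norm x.

Lemma weighted_ge0 m x : 0 <= weighted m x.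
Proof.
elim: m x => [|m IH] x /=; first exact: sigma_norm_ge0.
by rewrite mule_ge0// poweR_ge0.
Qed.

Lemma measurable_weighted m : measurable_fun setT (weighted m).
Proof.
elim: m => [|m IH] /=; first exact: measurable_sigma_norm.
apply: emeasurable_funM; last exact: (measurableT_comp IH (@measurable_tail _ _)).
exact: (measurableT_comp measurable_Kalpha (measurable_coord _)).
Qed.

Lemma integral_weighted m k : \int[P]_w weighted m (past eps k w) =
  (EKalpha ^+ m)%:E * \int[P]_w sigma_norm (past eps 0 w).
Proof.
elim: m => [|m IH] /=.
  rewrite expr0 mul1e; apply: integral_same_law.
  - exact: (measurable_past eps_iid).
  - exact: (measurable_past eps_iid).
  - exact: (same_law_past eps_iid).
  - exact: measurable_sigma_norm.
  - exact: sigma_norm_ge0.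
rewrite (integral_past_step eps_iid eps'_copy k measurable_Kalpha).
- by rewrite EKalphaE IH exprS EFinM muleA.
- by move=> x; exact: poweR_ge0.
- exact: measurable_weighted.
- exact: weighted_ge0.
Qed.

(** Induction on [m] with [k] free: for [m.+1] both paths start with the innovation at time [k - 1],
    the contraction extracts its [Kcoef], and the tails are coupled at time [k - 1] with [m] shared
    innovations. When none is left, the triangle inequality through zero bounds the distance by the
    two norms. *)
Lemma dist_coupled_le m k : {ae P, forall w,
  distH (g (past eps k w)) (g (coupled_past eps eps' k m w)) `^ alpha <=
  (2 `^ alpha)%:E *
    (weighted m (past eps k w) + weighted m (coupled_past eps eps' k m w))}.
Proof.
elim: m k => [|m IH] k.
  apply: aeW => w /=.
  set u := g _; set v := g _.
  apply: (@le_trans _ _ ((normH u + normH v) `^ alpha)).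
    apply: le_poweR; [exact: ltW|exact: distH_ge0|].
    rewrite -(distH0 u) -(distH0 v) (distHC v).
    exact: distH_triangle.
  (* Nothing has to contract here, so equal weights suffice and both constants are [2 ^ alpha]. *)
  have half : ((0 < 2^-1 :> R) && (2^-1 < 1 :> R))%R by apply/andP; split; lra.
  apply: le_trans (poweR_add_le half _ _ _ _) _;
    rewrite ?normH_ge0 ?normH_lty//.
  rewrite (_ : (1 - 2^-1)%R = 2^-1%R :> R); last by field.
  by rewrite invrK muleDr// ge0_adde_def// inE poweR_ge0.
apply: filterS2 (filterI (IH (k - 1)%R) (Kcoef_lty (k - 1)%R))
  (filterI (past_step k) (coupled_past_step k m.+1)) => w [le_w Kw] [].
rewrite /step_paths /= tail_past tail_coupled_past /coupled_past /= /past !subr0.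
rewrite -/(past eps (k - 1) w) -/(coupled_past eps eps' (k - 1) m w).
move=> st st'.
have K0 : 0 <= Kcoef beta (eps (k - 1)%R w) by exact: poweR_ge0.
apply: (@le_trans _ _ ((Kcoef beta (eps (k - 1)%R w) *
  distH (g (past eps (k - 1) w)) (g (coupled_past eps eps' (k - 1) m w))) `^ alpha)).
  apply: le_poweR; [exact: ltW|exact: distH_ge0|].
  exact: (garch_step_contraction mbeta Kw st st').
rewrite poweRM ?distH_ge0//.
apply: (@le_trans _ _ (Kcoef beta (eps (k - 1)%R w) `^ alpha * ((2 `^ alpha)%:E *
    (weighted m (past eps (k - 1) w) +
     weighted m (coupled_past eps eps' (k - 1) m w))))).
  by apply: lee_wpmul2l => //; exact: poweR_ge0.
rewrite muleCA; apply: lee_wpmul2l; first by rewrite lee_fin powR_ge0.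
by rewrite ge0_muleDr ?weighted_ge0.
Qed.

(** The two weighted terms have equal means because the coupled past has the law of the past, whence
    the factor 2. *)
Lemma integral_dist_coupled_le k m :
  \int[P]_w (distH (sigma2 k w) (g (coupled_past eps eps' k m w)) `^ alpha) <=
  (2 `^ alpha * 2 * fine (\int[P]_w sigma_norm (past eps 0 w)) *
    EKalpha ^+ m)%:E.
Proof.
have mp := measurable_past eps_iid k.
have mc := measurable_coupled_past eps_iid eps'_copy k m.
have mwp := measurableT_comp (measurable_weighted m) mp.
have mwc := measurableT_comp (measurable_weighted m) mc.
have two_ge0 : 0 <= (2 `^ alpha)%:E :> \bar R by rewrite lee_fin powR_ge0.
apply: (@le_trans _ _ (\int[P]_w ((2 `^ alpha)%:E *
    (weighted m (past eps k w) + weighted m (coupled_past eps eps' k m w))))).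
  rewrite (ae_eq_integral
    (fun w => distH (g (past eps k w)) (g (coupled_past eps eps' k m w)) `^ alpha)).
  - apply: ae_ge0_le_integral => //.
    + by move=> w _; exact: poweR_ge0.
    + apply: (measurableT_comp (measurable_poweR _)).
      by apply: measurable_distH; exact: measurableT_comp.
    + by move=> w _; rewrite mule_ge0// adde_ge0 ?weighted_ge0.
    + by apply: emeasurable_funM => //; exact: emeasurable_funD.
    + by apply: filterS (dist_coupled_le m k) => w.
  - exact: measurableT.
  - apply: (measurableT_comp (measurable_poweR _)).
    apply: measurable_distH; last exact: measurableT_comp.
    by case: sol.
  - apply: (measurableT_comp (measurable_poweR _)).
    by apply: measurable_distH; exact: measurableT_comp.
  - by apply: filterS (sigma2E k) => w -> _.
rewrite ge0_integralZl//; first last.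
- by move=> w _; rewrite adde_ge0 ?weighted_ge0.
- exact: emeasurable_funD.
rewrite ge0_integralD//; try by move=> w _; exact: weighted_ge0.
rewrite [X in _ * (_ + X)](integral_same_law mc mp); first last.
- exact: weighted_ge0.
- exact: measurable_weighted.
- exact: (same_law_coupled_past eps_iid eps'_copy).
rewrite integral_weighted.
have : \int[P]_w sigma_norm (past eps 0 w) \is a fin_num.
  rewrite ge0_fin_numE ?sigma_norm_integrable// integral_ge0// => w _.
  exact: sigma_norm_ge0.
move: (\int[P]_w sigma_norm (past eps 0 w)) => [C| |]// _.
rewrite [leLHS](_ : _ =
  (2 `^ alpha * (EKalpha ^+ m * C + EKalpha ^+ m * C))%:E)//.
rewrite lee_fin /= le_eqVlt; apply/orP; left; apply/eqP; ring.
Qed.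
End stationary_solution.

Theorem theorem2p2 (R : realType) (d : measure_display)
  (Omega : measurableType d) (P : probability Omega R)
  (eps eps' : int -> Omega -> Hsp R) (delta : Hsp R)
  (beta : R -> R -> R) (B : Hsp R -> Hsp R) (alpha : R)
  (y : int -> Omega -> L0 R) (sigma2 : int -> Omega -> Hsp R)
  (g : paths nat (Hsp R) -> Hsp R)
  (eps_iid : iid P eps)
  (delta_ge0 : Hplus delta)
  (beta_kernel : kernel_operator beta B)
  (beta_bounded : bounded_operator B)
  (beta_nonneg : nonneg_operator B)
  (alpha_gt0 : 0 < alpha)
  (EK_lt1 : (\int[P]_w (Kcoef beta (eps 1%R w) `^ alpha) < 1)%E)
  (sol : solution P eps delta beta y sigma2)
  (stationary : strictly_stationary P (fun k w => (y k w, sigma2 k w)))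
  (g_measurable : measurable_fun setT g)
  (sigma2E : forall k, {ae P, forall w, sigma2 k w = g (past eps k w)})
  (eps'_copy : independent_copy P eps eps') :
  exists r c : R, 0 < r < 1 /\
    forall (k : int) (m : nat), (1 <= m)%N ->
      (\int[P]_w (distH (sigma2 k w) (g (coupled_past eps eps' k m w)) `^ alpha)
         <= (c * r ^+ m)%:E)%E.
Proof.
have [mbeta _] := beta_kernel.
pose a := EKalpha P eps beta alpha.
have a0 : 0 <= a by exact: EKalpha_ge0.
have a1 : a < 1 by exact: EKalpha_lt1.
pose C := fine (\int[P]_w sigma_norm alpha g (past eps 0 w))%E.
have C0 : 0 <= C.
  by apply/fine_ge0/integral_ge0 => w _; exact: sigma_norm_ge0.
(* The midpoint of [a] and 1 replaces [a], which may vanish, since the rate has to be positive. *)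
exists ((1 + a) / 2), (2 `^ alpha * 2 * C); split.
  by apply/andP; split; lra.
move=> k m _; apply: le_trans.
  exact: (integral_dist_coupled_le eps_iid eps'_copy mbeta alpha_gt0 EK_lt1 sol
    g_measurable sigma2E k m).
rewrite lee_fin ler_wpM2l//; first by rewrite !mulr_ge0// powR_ge0.
by rewrite -/a; apply: lerXn2r; rewrite ?nnegrE; lra.
Qed.
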